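(* Let $\mathcal{G}$ and $\mathcal{H}$ be $d$-uniform hypergraphs, with adjacency matrices $\mathbb{A}_G$ and $\mathbb{A}_H$, such that $\mathcal{G}$ covers $\mathcal{H}$. Then for every perfect coloring of $\mathcal{H}$ with parameter matrix $\mathbb{S}$, there is a perfect coloring of $\mathcal{G}$ with the same parameter matrix $\mathbb{S}$.
   Context: A $d$-uniform hypergraph on vertex set $[n]$ has distinct $d$-element hyperedges. Its adjacency matrix $\mathbb{A}$ is the $d$-dimensional array with $a_{(x_1,\dots,x_d)}=1/(d-1)!$ if $\{x_1,\dots,x_d\}$ is a hyperedge, and $0$ otherwise. A coloring into $k$ colors is a surjective map $f:[n]\to[k]$ with color matrix $P$ ($n\times k$, $p_{x,i}=1$ iff $f(x)=i$). We use $$(\mathbb{A}\circ P)_{x,j_1,\dots,j_{d-1}}=\sum_{x_1,\dots,x_{d-1}}a_{x,x_1,\dots,x_{d-1}}p_{x_1,j_1}\cdots p_{x_{d-1},j_{d-1}},\qquad (P\circ\mathbb{S})_{x,\beta}=\sum_ip_{x,i}s_{i,\beta}.$$ The coloring is perfect if there is a $d$-dimensional $\mathbb{S}$ of order $k$ with $\mathbb{A}\circ P=P\circ\mathbb{S}$ (equivalently, all vertices of the same color lie in equally many hyperedges of each color range, the color range of $e$ being the multiset $\{f(x):x\in e\}$); $\mathbb{S}$ is the parameter matrix. $\mathcal{G}$ covers $\mathcal{H}$ if there is a surjective map $\varphi:X(\mathcal{G})\to X(\mathcal{H})$ with the following properties: - for each hyperedge $e$ of $\mathcal{G}$, $\varphi$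 is injective on $e$ and $\varphi(e)$ is a hyperedge of $\mathcal{H}$; - for each vertex $x$, $e\mapsto\varphi(e)$ is a bijection from hyperedges containing $x$ onto hyperedges containing $\varphi(x)$. *)

(* Defs.v *)
From HB Require Import structures.
From mathcomp Require Import all_boot all_order all_algebra.

Set Implicit Arguments.
Unset Strict Implicit.
Unset Printing Implicit Defensive.

Import GRing.Theory Num.Theory.
Local Open Scope ring_scope.

Record hypergraph (d n : nat) := Hypergraph {
  hyperedges : {set {set 'I_n}};
  hyperedges_uniform : forall e, e \in hyperedges -> #|e| = d
}.

Definition surjective (aT rT : Type) (f : aT -> rT) : Prop :=
  forall y, exists x, f x = y.

Definition array (R : Type) (d n : nat) := {ffun d.-tuple 'I_n -> R}.

(* The uniformity is written d.+1, so that the factor 1/(uniformity - 1)! is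
   1/d! and an array index is x :: y with y a d-tuple. If the entries of x are
   not distinct, their set has fewer than d.+1 elements and is no hyperedge. *)
Definition adjacency (R : numFieldType) (d n : nat) (G : hypergraph d.+1 n) :
    array R d.+1 n :=
  [ffun x : d.+1.-tuple 'I_n =>
     if [set y in x] \in hyperedges G then 1 / (d`!)%:R else 0].

Definition color_mx (R : numFieldType) (n k : nat) (f : 'I_n -> 'I_k) :
    'M[R]_(n, k) :=
  \matrix_(x < n, i < k) (f x == i)%:R.

Definition array_circ_mx (R : numFieldType) (d n k : nat)
    (A : array R d.+1 n) (P : 'M[R]_(n, k)) :
    {ffun 'I_n * d.-tuple 'I_k -> R} :=
  [ffun xj : 'I_n * d.-tuple 'I_k =>
     \sum_(y : d.-tuple 'I_n)
       A [tuple of xj.1 :: y] * \prod_(l < d) P (tnth y l) (tnth xj.2 l)].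

Definition mx_circ_array (R : numFieldType) (d n k : nat)
    (P : 'M[R]_(n, k)) (S : array R d.+1 k) :
    {ffun 'I_n * d.-tuple 'I_k -> R} :=
  [ffun xj : 'I_n * d.-tuple 'I_k =>
     \sum_(i < k) P xj.1 i * S [tuple of i :: xj.2]].

Definition perfect_coloring_with (R : numFieldType) (d n k : nat)
    (G : hypergraph d.+1 n) (f : 'I_n -> 'I_k) (S : array R d.+1 k) : Prop :=
  surjective f /\
  array_circ_mx (adjacency R G) (color_mx R f)
    = mx_circ_array (color_mx R f) S.

Definition incident (d n : nat) (G : hypergraph d n) (x : 'I_n) :
    {set {set 'I_n}} :=
  [set e in hyperedges G | x \in e].

Definition covering_map (d n m : nat) (G : hypergraph d n) (H : hypergraph d m)
    (phi : 'I_n -> 'I_m) : Prop :=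
  [/\ surjective phi,
      forall e, e \in hyperedges G ->
        {in e &, injective phi} /\ phi @: e \in hyperedges H
    & forall x,
        {in incident G x &, injective (fun e : {set 'I_n} => phi @: e)} /\
        [set phi @: (e : {set 'I_n}) | e in incident G x]
          = incident H (phi x)].

Definition covers (d n m : nat) (G : hypergraph d n) (H : hypergraph d m) :
    Prop :=
  exists phi : 'I_n -> 'I_m, covering_map G H phi.

(* Main.v *)
Require Import Defs.
From HB Require Import structures.
From mathcomp Require Import all_boot all_order all_algebra.

(** Pull the coloring [f] of [H] back along the covering map [phi]. For each
    vertex [x] of [G], applying [phi] entrywise is a bijection from the tuples
    [y] such that [x :: y] enumerates a hyperedge of [G] onto the tuples [z]
    such that [phi x :: z] enumerates a hyperedge of [H]; reindexing the sum
    that defines [A o P] along it shows that its entries at [x] for [f \o phi]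
    are its entries at [phi x] for [f]. *)

Set Implicit Arguments.
Unset Strict Implicit.
Unset Printing Implicit Defensive.

Import GRing.Theory.
Local Open Scope ring_scope.

(** The ordered link of [x]: the tuples [y] at which the entry of the adjacency array at [x :: y] is
    nonzero. *)
Definition link_tuples (d n : nat) (G : hypergraph d.+1 n) (x : 'I_n) :
    {set d.-tuple 'I_n} :=
  [set y : d.-tuple 'I_n | [set u in x :: y] \in hyperedges G].

Lemma imset_set_seq (aT rT : finType) (h : aT -> rT) (s : seq aT) :
  h @: [set u in s] = [set v in map h s].
Proof.
apply/setP=> v; rewrite inE; apply/imsetP/mapP.
  by case=> u; rewrite inE => us ->; exists u.
by case=> u us ->; exists u; rewrite ?inE.
Qed.

Section CoveringMap.

Variables (d n m : nat) (G : hypergraph d.+1 n) (H : hypergraph d.+1 m).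
Variable phi : 'I_n -> 'I_m.
Hypothesis phi_cover : covering_map G H phi.

(** Two tuples with the same image span, together with [x], hyperedges with the same image. These
    hyperedges coincide because [phi] is injective on those incident to [x], and injectivity of
    [phi] on the common hyperedge then gives equality entry by entry. *)
Lemma map_tuple_link_inj (x : 'I_n) :
  {in link_tuples G x &, injective (map_tuple (n := d) phi)}.
Proof.
case: phi_cover => _ phi_edge /(_ x) [phi_inj _] y y'.
rewrite !inE => Ey Ey' /(congr1 val) /= eq_phi.
have eq_e : [set u in x :: y] = [set u in x :: y'].
  by apply: phi_inj; rewrite ?inE ?Ey ?Ey' ?eqxx // !imset_set_seq /= eq_phi.
have [phi_inj_e _] := phi_edge _ Ey.
apply/val_inj/(inj_in_map phi_inj_e) => //.
  by apply/allP=> u yu; rewrite !inE yu orbT.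
by apply/allP=> u yu; rewrite eq_e !inE yu orbT.
Qed.

Lemma map_tuple_link_im (x : 'I_n) :
  map_tuple phi @: link_tuples G x = link_tuples H (phi x).
Proof.
case: phi_cover => _ phi_edge /(_ x) [_ phi_onto].
apply/setP=> z; apply/imsetP/idP => [[y] | ].
  rewrite inE => /phi_edge[_ Ey ->].
  by rewrite inE; move: Ey; rewrite imset_set_seq.
rewrite inE => Ez.
have: [set v in phi x :: z] \in incident H (phi x).
  by rewrite inE Ez !inE eqxx.
rewrite -phi_onto => /imsetP[e]; rewrite inE => /andP[Ge xe] def_e.
(* A section of [phi] over [phi @: e], where [e] is the lifted hyperedge through [x]. All entries of
   [z] lie in [phi @: e], so the default [x] is never taken on them. *)
pose psi v := odflt x [pick u in e | phi u == v].
have psiP v : v \in z -> psi v \in e /\ phi (psi v) = v.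
  move=> zv; have: v \in phi @: e by rewrite -def_e !inE zv orbT.
  case/imsetP=> u ue def_v; rewrite /psi.
  case: pickP => [w /andP[we /eqP] // | /(_ u)].
  by rewrite ue def_v eqxx.
have phi_psi : map phi (map psi z) = z.
  by rewrite -map_comp map_id_in // => v /psiP[].
exists (map_tuple psi z); last exact/val_inj/esym.
rewrite inE /=; suff -> : [set u in x :: map psi z] = e by [].
(* Both sets have exactly [d.+1] elements. *)
apply/eqP; rewrite eqEcard; apply/andP; split.
  apply/subsetP=> u; rewrite !inE => /predU1P[-> // | /mapP[v /psiP[pe _] ->]].
  exact: pe.
rewrite (hyperedges_uniform Ge) -(hyperedges_uniform Ez).
have <- : phi @: [set u in x :: map psi z] = [set v in phi x :: z].
  by rewrite imset_set_seq /= phi_psi.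
exact: leq_imset_card.
Qed.

End CoveringMap.

Lemma array_circ_color_mxE (R : numFieldType) (d n k : nat)
    (G : hypergraph d.+1 n) (f : 'I_n -> 'I_k) (x : 'I_n) (j : d.-tuple 'I_k) :
  array_circ_mx (adjacency R G) (color_mx R f) (x, j) =
  \sum_(y in link_tuples G x)
    1 / (d`!)%:R * \prod_(l < d) (f (tnth y l) == tnth j l)%:R.
Proof.
rewrite ffunE [RHS]big_mkcond; apply: eq_bigr => y _; rewrite ffunE inE /=.
case: ifP => _; last by rewrite mul0r.
by congr (_ * _); apply: eq_bigr => l _; rewrite mxE.
Qed.

Lemma perfect_coloring_pullback (R : numFieldType) (d n m k : nat)
    (G : hypergraph d.+1 n) (H : hypergraph d.+1 m) (phi : 'I_n -> 'I_m)
    (f : 'I_m -> 'I_k) (S : array R d.+1 k) :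
  covering_map G H phi -> perfect_coloring_with H f S ->
  perfect_coloring_with G (f \o phi) S.
Proof.
move=> phi_cover [f_surj f_perf]; split.
  move=> i; have [v <-] := f_surj i; case: phi_cover => /(_ v)[x <-] _ _.
  by exists x.
apply/ffunP=> -[x j]; rewrite array_circ_color_mxE.
have /ffunP/(_ (phi x, j)) := f_perf.
rewrite array_circ_color_mxE -(map_tuple_link_im phi_cover).
(* Substituting the image of [y] for [z] turns the colors [f z_l] into [f (phi y_l)], the colors of
   [y] in the pullback. *)
rewrite (big_imset _ (map_tuple_link_inj phi_cover (x := x))) /=.
under eq_bigr do under eq_bigr do rewrite tnth_map.
(* Vertices [x] and [phi x] have the same color, so their rows in the two color matrices agree. *)
move=> ->; rewrite !ffunE; apply: eq_bigr => i _.
by rewrite !mxE.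
Qed.

Theorem theorem11 (R : numFieldType) (d n m : nat)
    (G : hypergraph d.+1 n) (H : hypergraph d.+1 m) (hGH : covers G H)
    (k : nat) (f : 'I_m -> 'I_k) (S : array R d.+1 k)
    (hf : perfect_coloring_with H f S) :
  exists g : 'I_n -> 'I_k, perfect_coloring_with G g S.
Proof.
by case: hGH => phi phi_cover; exists (f \o phi); apply: perfect_coloring_pullback hf.
Qed.
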